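(* Let $\mathcal{A}\in\mathbb{C}^{\mathbf{I}(N)\times\mathbf{I}(N)}$ be a tensor with index $k$. If $l$ is any integer with $l\ge k$, then $\mathcal{A}^{D}=\mathcal{X}^{\dagger}$, where $$\mathcal{X}=(\mathcal{A}^{l})^{\dagger}*_N\mathcal{A}^{2l+1}*_N(\mathcal{A}^{l})^{\dagger}.$$
   Context: For positive integers $I_1,\dots,I_N$ write $\mathbf{I}(N)=I_1\times\cdots\times I_N$; $\mathbb{C}^{\mathbf{I}(N)\times\mathbf{J}(N)}$ is the set of complex tensors with entries $a_{i_1\dots i_N j_1\dots j_N}$, $1\le i_s\le I_s$, $1\le j_s\le J_s$. The Einstein product of $\mathcal{A}\in\mathbb{C}^{\mathbf{I}(N)\times\mathbf{K}(N)}$ and $\mathcal{B}\in\mathbb{C}^{\mathbf{K}(N)\times\mathbf{J}(N)}$ is $(\mathcal{A}*_N\mathcal{B})_{i_1\dots i_N j_1\dots j_N}=\sum_{k_1,\dots,k_N}a_{i_1\dots i_N k_1\dots k_N}b_{k_1\dots k_N j_1\dots j_N}$; similarly $\mathcal{A}*_N\mathcal{X}\in\mathbb{C}^{\mathbf{I}(N)}$ for $\mathcal{X}\in\mathbb{C}^{\mathbf{K}(N)}$. Powers of $\mathcal{A}\in\mathbb{C}^{\mathbf{I}(N)\times\mathbf{I}(N)}$ are taken with $*_N$, and $\mathcal{A}^0=\mathcal{I}$ is the identity tensor. The range of $\mathcal{A}$ is $\mathfrak{R}(\mathcal{A})=\{\mathcal{A}*_N\mathcal{X}:\mathcal{X}\in\mathbb{C}^{\mathbf{I}(N)}\}$.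 The index $\mathrm{ind}(\mathcal{A})$ is the smallest nonnegative integer $k$ with $\mathfrak{R}(\mathcal{A}^k)=\mathfrak{R}(\mathcal{A}^{k+1})$. The Drazin inverse $\mathcal{A}^D$ of $\mathcal{A}$ with $\mathrm{ind}(\mathcal{A})=k$ is the (unique, always existing) tensor $\mathcal{X}\in\mathbb{C}^{\mathbf{I}(N)\times\mathbf{I}(N)}$ with $\mathcal{A}^{k+1}*_N\mathcal{X}=\mathcal{A}^k$, $\mathcal{X}*_N\mathcal{A}*_N\mathcal{X}=\mathcal{X}$, $\mathcal{A}*_N\mathcal{X}=\mathcal{X}*_N\mathcal{A}$. The conjugate transpose is $(\mathcal{A}^* )_{i_1\dots i_Nj_1\dots j_N}=\overline{a_{j_1\dots j_Ni_1\dots i_N}}$. The Moore-Penrose inverse $\mathcal{A}^\dagger$ is the unique $\mathcal{X}$ with $\mathcal{A}*_N\mathcal{X}*_N\mathcal{A}=\mathcal{A}$, $\mathcal{X}*_N\mathcal{A}*_N\mathcal{X}=\mathcal{X}$, $(\mathcal{A}*_N\mathcal{X})^*=\mathcal{A}*_N\mathcal{X}$, $(\mathcal{X}*_N\mathcal{A})^*=\mathcal{X}*_N\mathcal{A}$. *)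

(* Defs.v *)
From mathcomp Require Import all_boot all_order all_algebra.
From mathcomp Require Import complex.
From mathcomp Require Import boolp classical_sets reals.

Set Implicit Arguments.
Unset Strict Implicit.
Unset Printing Implicit Defensive.

Import Order.TTheory GRing.Theory Num.Theory.

Local Open Scope ring_scope.
Local Open Scope classical_set_scope.

(* Multi-indices (i_1, ..., i_N) with 0 <= i_s < I_s: indices start at 0. *)
Definition mindex (N : nat) (I : 'I_N -> nat) : finType :=
  {dffun forall s : 'I_N, 'I_(I s)}.

(* C^{I(N)}, and C^{I(N) x J(N)} whose entry a_{i_1...i_N j_1...j_N} is
   [A (i, j)]. *)
Definition vtensor (C : numClosedFieldType) (N : nat) (I : 'I_N -> nat) :=
  {ffun mindex I -> C}.

Definition tensor (C : numClosedFieldType) (N : nat) (I J : 'I_N -> nat) :=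
  {ffun mindex I * mindex J -> C}.

Section Tensors.
Context {C : numClosedFieldType} {N : nat}.
Implicit Types I J K : 'I_N -> nat.

Definition einprod I K J (A : tensor C I K) (B : tensor C K J) :
    tensor C I J :=
  [ffun p => \sum_(k : mindex K) A (p.1, k) * B (k, p.2)].

Definition einapp I K (A : tensor C I K) (X : vtensor C K) : vtensor C I :=
  [ffun i => \sum_(k : mindex K) A (i, k) * X k].

Definition tid I : tensor C I I := [ffun p => (p.1 == p.2)%:R].

Definition tpow I (A : tensor C I I) (n : nat) : tensor C I I :=
  iter n (einprod A) (tid I).

Definition tconj I J (A : tensor C I J) : tensor C J I :=
  [ffun p => (A (p.2, p.1))^*].

Definition trange I J (A : tensor C I J) : set (vtensor C I) :=
  range (einapp A).

Definition is_tind I (A : tensor C I I) (k : nat) : Prop :=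
  trange (tpow A k) = trange (tpow A k.+1) /\
  forall j : nat, trange (tpow A j) = trange (tpow A j.+1) -> (k <= j)%N.

(* [tind], [drazin] and [pinv] select the object satisfying the defining
   property by choice. Such an object always exists and is unique, so the
   default values 0 are never reached. *)
Definition tind I (A : tensor C I I) : nat := xget 0%N [set k | is_tind A k].

Definition is_drazin I (A X : tensor C I I) : Prop :=
  [/\ einprod (tpow A (tind A).+1) X = tpow A (tind A),
      einprod (einprod X A) X = X
    & einprod A X = einprod X A].

Definition drazin I (A : tensor C I I) : tensor C I I :=
  xget [ffun=> 0] [set X | is_drazin A X].

Definition is_pinv I J (A : tensor C I J) (X : tensor C J I) : Prop :=
  [/\ einprod (einprod A X) A = A,
      einprod (einprod X A) X = X,
      tconj (einprod A X) = einprod A X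
    & tconj (einprod X A) = einprod X A].

Definition pinv I J (A : tensor C I J) : tensor C J I :=
  xget [ffun=> 0] [set X | is_pinv A X].

End Tensors.

Notation "A *_N B" := (einprod A B)
  (at level 40, left associativity) : ring_scope.

(* Main.v *)
(* Write D for the Drazin inverse, B = A^l and X = B^+ A^(2l+1) B^+.  Since
   l >= ind A, both D = A^l D^(l+1) = D^(l+1) A^l and A^(l+1) D = A^l; together
   with B B^+ B = B these give X D = B^+ B and D X = B B^+, which are
   self-adjoint projections, and the Penrose equations for (X, D) follow.

   Flattening multi-indices identifies tensors with matrices.  There the
   Moore-Penrose inverse comes from a full rank factorization, and the Drazin
   inverse is A^k Y^(k+1) = Z^(k+1) A^k, where equality of the ranks of A^k and
   A^(k+1) provides Y and Z with A^k = A^(k+1) Y = Z A^(k+1). *)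
Require Import Defs.
From mathcomp Require Import all_boot all_order all_algebra.
From mathcomp Require Import complex.
From mathcomp Require Import reals.
From mathcomp Require Import boolp classical_sets.
Import Order.TTheory GRing.Theory Num.Theory.
Local Open Scope ring_scope.
Local Open Scope sesquilinear_scope.

(** * Drazin inverses in an abstract semiring *)

Section DrazinAlgebra.
Context {R : pzSemiRingType}.
Implicit Types A B D X Y Z : R.

(** The exponent is a free parameter, not the index, so that it can be raised to the given [l]. *)
Definition is_drazin_at (k : nat) A X :=
  [/\ A ^+ k.+1 * X = A ^+ k, X * A * X = X & A * X = X * A].

Lemma is_drazin_at_exists A Y Z k :
  A ^+ k = A ^+ k.+1 * Y -> A ^+ k = Z * A ^+ k.+1 ->
  exists X, is_drazin_at k A X.
Proof.
move=> AY ZA.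
have AYj j : A ^+ (k + j) * Y ^+ j = A ^+ k.
  elim: j => [|j IHj]; first by rewrite addn0 mulr1.
  rewrite addnS -addSn addnC exprD (exprS Y) !mulrA -(mulrA _ _ Y) -AY.
  by rewrite -exprD addnC.
have ZAj j : Z ^+ j * A ^+ (k + j) = A ^+ k.
  elim: j => [|j IHj]; first by rewrite addn0 mul1r.
  rewrite addnS -addSn exprD (exprSr Z) !mulrA -(mulrA _ Z) -ZA.
  by rewrite -mulrA -exprD.
(* Both sides equal Z^(k+1) A^(2k+1) Y^(k+1). *)
have XE : A ^+ k * Y ^+ k.+1 = Z ^+ k.+1 * A ^+ k.
  by rewrite -{1}(ZAj k.+1) -mulrA AYj.
have AX : A * (A ^+ k * Y ^+ k.+1) = A ^+ k * Y ^+ k.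
  by rewrite mulrA -exprS (exprS Y) mulrA -AY.
have XA : A ^+ k * Y ^+ k.+1 * A = Z ^+ k * A ^+ k.
  by rewrite XE -mulrA -exprSr (exprSr Z) -mulrA -ZA.
(* Both sides equal Z^k A^(2k) Y^k. *)
have AC : A * (A ^+ k * Y ^+ k.+1) = A ^+ k * Y ^+ k.+1 * A.
  by rewrite AX XA -{1}(ZAj k) -mulrA AYj.
exists (A ^+ k * Y ^+ k.+1); split => //.
- by rewrite mulrA -exprD addnC addnS -addnS AYj.
- by rewrite XA mulrA -(mulrA (Z ^+ k)) -exprD ZAj.
Qed.

Lemma is_drazin_at_le A D k l :
  (k <= l)%N -> is_drazin_at k A D -> is_drazin_at l A D.
Proof.
move=> kl [AD DAD AC]; split => //.
by rewrite -(subnK kl) -addnS !exprD -mulrA AD.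
Qed.

(** Here [B] stands for the inverse of A^k, later its Moore-Penrose inverse. Writing [D] with a
    factor A^k next to [B] creates A^k B A^k, which collapses to A^k. *)
Lemma drazin_inner_inverse A D B k :
  is_drazin_at k A D -> A ^+ k * B * A ^+ k = A ^+ k ->
  [/\ B * A ^+ (2 * k + 1) * B * D = B * A ^+ k,
      D * (B * A ^+ (2 * k + 1) * B) = A ^+ k * B
    & A ^+ k * B * D = D].
Proof.
move=> [AD DAD AC] ABA.
have ADj j : A ^+ (k + j) * D ^+ j = A ^+ k.
  elim: j => [|j IHj]; first by rewrite addn0 mulr1.
  rewrite addnS -addSn addnC exprD (exprS D) !mulrA -(mulrA _ _ D) AD.
  by rewrite -exprD addnC.
(* Iterates D = A D^2, which follows from D A D = D by commutation. *)
have Dl j : D = A ^+ j * D ^+ j.+1.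
  elim: j => [|j {1}->]; first by rewrite mul1r.
  rewrite (exprSr A) (exprS D j.+1) (exprS D j) !mulrA -!(mulrA (A ^+ j)) AC.
  by rewrite DAD.
have Dr : D = D ^+ k.+1 * A ^+ k.
  by rewrite {1}(Dl k); apply/commrX/commr_sym/commrX.
have DAj : D ^+ k.+1 * A ^+ (k + k.+1) = A ^+ k.
  by rewrite -[RHS](ADj k.+1); apply/commr_sym/commrX/commr_sym/commrX.
have -> : (2 * k + 1 = k + k.+1)%N by rewrite mul2n -addnn addn1 addnS.
split; last by rewrite {1}(Dl k) mulrA ABA -Dl.
  have -> : B * A ^+ (k + k.+1) * B * D =
            B * A ^+ k.+1 * (A ^+ k * B * A ^+ k) * D ^+ k.+1.
    by rewrite {1}(Dl k) addnC exprD !mulrA.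
  by rewrite ABA -!mulrA [A ^+ k.+1 * _]mulrA -exprD addnC ADj.
have -> : D * (B * A ^+ (k + k.+1) * B) =
          D ^+ k.+1 * (A ^+ k * B * A ^+ k) * (A ^+ k.+1 * B).
  by rewrite {1}Dr exprD !mulrA.
by rewrite ABA -mulrA [A ^+ k * _]mulrA -exprD mulrA DAj.
Qed.
End DrazinAlgebra.

(** * Stabilisation of the ranks of matrix powers *)

Section StablePower.
Context {F : fieldType} {n : nat}.
Implicit Types M : 'M[F]_n.

(** The row space of M^(k+1) lies in that of M^k, so equal ranks force equal row spaces. *)
Lemma rank_expr_eq_left M k :
  \rank (M ^+ k.+1) = \rank (M ^+ k) <-> exists Z, M ^+ k = Z * M ^+ k.+1.
Proof.
have sub : (M ^+ k.+1 <= M ^+ k)%MS by rewrite exprS submxMl.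
split=> [/eqP | [Z MZ]]; first by rewrite (mxrank_leqif_sup sub) => /submxP.
by apply/eqP; rewrite (mxrank_leqif_sup sub); apply/submxP; exists Z.
Qed.

(** The column space analogue, by transposition. One rank equality thus gives factorizations on both
    sides. *)
Lemma rank_expr_eq_right M k :
  \rank (M ^+ k.+1) = \rank (M ^+ k) <-> exists Y, M ^+ k = M ^+ k.+1 * Y.
Proof.
have sub : ((M ^+ k.+1)^T <= (M ^+ k)^T)%MS by rewrite exprSr trmx_mul submxMl.
rewrite -(mxrank_tr (M ^+ k.+1)) -(mxrank_tr (M ^+ k)).
split=> [/eqP | [Y MY]].
  rewrite (mxrank_leqif_sup sub) => /submxP[Y MY].
  by exists Y^T; apply: trmx_inj; rewrite MY -mulmxE trmx_mul trmxK.
apply/eqP; rewrite (mxrank_leqif_sup sub) {1}MY.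
by rewrite -mulmxE trmx_mul submxMl.
Qed.

Lemma rank_expr_stationary M :
  exists k, \rank (M ^+ k.+1) = \rank (M ^+ k).
Proof.
apply: contrapT => nst.
(* If the rank never stabilised, it would drop by at least one at each step, which is absurd at n +
   1. *)
have dec k : (\rank (M ^+ k) + k <= n)%N.
  elim: k => [|k IHk]; first by rewrite addn0 rank_leq_row.
  apply: leq_trans IHk; rewrite addnS ltn_add2r ltn_neqAle.
  rewrite [M ^+ k.+1]exprS mxrankM_maxr andbT -[_ * _]exprS.
  by apply/eqP => e; apply: nst; exists k.
by have := dec n.+1; rewrite addnS ltnNge leq_addl.
Qed.

End StablePower.

(** * Existence and uniqueness of the Moore-Penrose inverse of a matrix *)

Section MoorePenrose.
Context {C : numClosedFieldType}.

Definition is_mxpinv {m n} (A : 'M[C]_(m, n)) (X : 'M[C]_(n, m)) :=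
  [/\ A *m X *m A = A, X *m A *m X = X,
      (A *m X)^t* = A *m X & (X *m A)^t* = X *m A].

Lemma trmxC_mul {m n p} (A : 'M[C]_(m, n)) (B : 'M[C]_(n, p)) :
  (A *m B)^t* = B^t* *m A^t*.
Proof. by rewrite trmx_mul map_mxM. Qed.

Lemma trmxC_inv {n} (A : 'M[C]_n) : (invmx A)^t* = invmx (A^t*).
Proof. by rewrite trmx_inv map_invmx. Qed.

(** If v G G^* = 0, then v G has norm zero, so v G = 0 and v = 0. *)
Lemma gram_unitmx {m n} (G : 'M[C]_(m, n)) :
  row_free G -> G *m G^t* \in unitmx.
Proof.
move=> Gfree; rewrite -row_free_unit; apply: inj_row_free => v vGG.
apply: (row_free_inj Gfree); rewrite mul0mx.
have := dotmxE (v *m G) (v *m G).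
rewrite trmxC_mul mulmxA -(mulmxA v) vGG mul0mx mxE => dot0.
by apply/eqP; rewrite -(dnorm_eq0 (@dotmx C n)); apply/eqP.
Qed.

(** The witness is a right inverse of [G] times a left inverse of [F]. Both products with F G are
    then visibly hermitian. *)
Lemma is_mxpinv_factor {m r n} (F : 'M[C]_(m, r)) (G : 'M[C]_(r, n)) :
  F^t* *m F \in unitmx -> G *m G^t* \in unitmx ->
  is_mxpinv (F *m G)
    (G^t* *m invmx (G *m G^t*) *m (invmx (F^t* *m F) *m F^t*)).
Proof.
move=> FU GU.
set X := (X in is_mxpinv _ X).
have AX : F *m G *m X = F *m invmx (F^t* *m F) *m F^t*.
  by rewrite /X -!mulmxA (mulmxA G) mulKVmx.
have XA : X *m (F *m G) = G^t* *m invmx (G *m G^t*) *m G.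
  by rewrite /X -!mulmxA (mulmxA _ F) mulKmx.
split.
- by rewrite AX -!mulmxA (mulmxA _ F) mulKmx.
- by rewrite XA /X -!mulmxA (mulmxA G) mulKVmx.
- by rewrite AX !trmxC_mul trmxC_inv trmxC_mul trmxCK mulmxA.
- by rewrite XA !trmxC_mul trmxC_inv trmxC_mul trmxCK mulmxA.
Qed.

Lemma is_mxpinv_exists {m n} (A : 'M[C]_(m, n)) : exists X, is_mxpinv A X.
Proof.
rewrite -(mulmx_base A); eexists; apply: is_mxpinv_factor; last first.
  by apply: gram_unitmx; apply: row_base_free.
have := gram_unitmx ((col_base A)^t*); rewrite trmxCK; apply.
by rewrite /row_free mxrank_map mxrank_tr -/(row_full _) col_base_full.
Qed.

Lemma is_mxpinv_uniq {m n} {A : 'M[C]_(m, n)} {X Y} :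
  is_mxpinv A X -> is_mxpinv A Y -> X = Y.
Proof.
move=> [AXA XAX AXh XAh] [AYA YAY AYh YAh].
(* A X = (A X)^* = (A Y A X)^* = A X A Y = A Y. *)
have AXY : A *m X = A *m Y.
  by rewrite -AXh -{1}AYA -mulmxA trmxC_mul AXh AYh mulmxA AXA.
have XYA : X *m A = Y *m A.
  rewrite -XAh -{1}AYA -(mulmxA A) mulmxA trmxC_mul XAh YAh.
  by rewrite -mulmxA (mulmxA A) AXA.
by rewrite -XAX XYA -mulmxA AXY mulmxA.
Qed.

End MoorePenrose.

(** * Transfer between tensors and matrices *)

Section TensorMatrix.
Context {C : numClosedFieldType} {N : nat}.
Implicit Types I J K : 'I_N -> nat.

Definition tensor_mx {I J} (A : tensor C I J) :
    'M[C]_(#|mindex I|, #|mindex J|) :=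
  \matrix_(i, j) A (enum_val i, enum_val j).

Definition mx_tensor {I J} (M : 'M[C]_(#|mindex I|, #|mindex J|)) :
    tensor C I J :=
  [ffun p => M (enum_rank p.1) (enum_rank p.2)].

Lemma mx_tensorK {I J} : cancel (@mx_tensor I J) tensor_mx.
Proof. by move=> M; apply/matrixP => i j; rewrite mxE ffunE !enum_valK. Qed.

Lemma tensor_mxK {I J} : cancel (@tensor_mx I J) mx_tensor.
Proof. by move=> A; apply/ffunP => -[i j]; rewrite ffunE mxE !enum_rankK. Qed.

Lemma tensor_mx_inj {I J} : injective (@tensor_mx I J).
Proof. exact: can_inj tensor_mxK. Qed.

Lemma tensor_mxM {I K J} (A : tensor C I K) (B : tensor C K J) :
  tensor_mx (A *_N B) = tensor_mx A *m tensor_mx B.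
Proof.
apply/matrixP => i j; rewrite !mxE ffunE /=.
rewrite (reindex _ (onW_bij _ (@enum_val_bij (mindex K)))).
by apply: eq_bigr => k _; rewrite !mxE.
Qed.

Lemma tensor_mx_conj {I J} (A : tensor C I J) :
  tensor_mx (tconj A) = (tensor_mx A)^t*.
Proof. by apply/matrixP => i j; rewrite !mxE ffunE. Qed.

Lemma tensor_mxX {I} (A : tensor C I I) n :
  tensor_mx (tpow A n) = tensor_mx A ^+ n.
Proof.
elim: n => [|n IHn]; last by rewrite tensor_mxM IHn exprS.
by apply/matrixP => i j; rewrite !mxE ffunE (inj_eq enum_val_inj).
Qed.

Lemma is_pinvE {I J} (A : tensor C I J) (X : tensor C J I) :
  is_pinv A X <-> is_mxpinv (tensor_mx A) (tensor_mx X).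
Proof.
split=> -[e1 e2 e3 e4]; split.
- by rewrite -!tensor_mxM e1.
- by rewrite -!tensor_mxM e2.
- by rewrite -!tensor_mxM -tensor_mx_conj e3.
- by rewrite -!tensor_mxM -tensor_mx_conj e4.
- by apply: tensor_mx_inj; rewrite !tensor_mxM.
- by apply: tensor_mx_inj; rewrite !tensor_mxM.
- by apply: tensor_mx_inj; rewrite tensor_mx_conj !tensor_mxM.
- by apply: tensor_mx_inj; rewrite tensor_mx_conj !tensor_mxM.
Qed.

Lemma pinvP {I J} (A : tensor C I J) : is_pinv A (pinv A).
Proof.
have [X AX] := is_mxpinv_exists (tensor_mx A).
suff : [set Y | is_pinv A Y]%classic (pinv A) by [].
apply: (@xgetPex _ _ [set Y | is_pinv A Y]%classic).
by exists (mx_tensor X); apply/is_pinvE; rewrite mx_tensorK.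
Qed.

Lemma pinv_eq {I J} (A : tensor C I J) (X : tensor C J I) :
  is_pinv A X -> pinv A = X.
Proof.
move=> /is_pinvE AX; apply: tensor_mx_inj.
exact: is_mxpinv_uniq (proj1 (is_pinvE _ _) (pinvP A)) AX.
Qed.

Lemma einappM {I K J} (A : tensor C I K) (B : tensor C K J) (X : vtensor C J) :
  einapp (A *_N B) X = einapp A (einapp B X).
Proof.
apply/ffunP => i; rewrite !ffunE.
under eq_bigr do rewrite ffunE mulr_suml.
rewrite exchange_big; apply: eq_bigr => k _; rewrite ffunE mulr_sumr.
by apply: eq_bigr => j _; rewrite mulrA.
Qed.

Lemma trange_subP {I J K} (A : tensor C I J) (B : tensor C I K) :
  (trange A `<=` trange B)%classic <-> exists Y, A = B *_N Y.
Proof.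
split=> [AB | [Y ->] _ [X _ <-]]; last by exists (einapp Y X); rewrite ?einappM.
have /choice[f fE] (j : mindex J) :
    exists X, einapp B X = [ffun i => A (i, j)].
  have [|X _ <-] := AB [ffun i => A (i, j)]; last by exists X.
  (* The unit tensor at [j] is sent to column [j] of [A]; the chosen preimages under [B] are the
     columns of Y. *)
  exists [ffun j' => (j' == j)%:R] => //; apply/ffunP => i; rewrite !ffunE.
  rewrite (bigD1 j) //= ffunE eqxx mulr1 big1 ?addr0 // => j' /negPf jj'.
  by rewrite ffunE jj' mulr0.
exists [ffun p => f p.2 p.1]; apply/ffunP => -[i j].
have /ffunP/(_ i) := fE j; rewrite !ffunE /= => <-.
by apply: eq_bigr => k _; rewrite ffunE.
Qed.

(** This turns the index, defined by ranges, into a condition on ranks. *)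
Lemma trange_tpow_eqE {I} (A : tensor C I I) j :
  trange (tpow A j) = trange (tpow A j.+1) <->
  \rank (tensor_mx A ^+ j.+1) = \rank (tensor_mx A ^+ j).
Proof.
split=> [e | /rank_expr_eq_right[Y AY]].
  have /trange_subP[Y AY] :
      (trange (tpow A j) `<=` trange (tpow A j.+1))%classic by rewrite e.
  apply/rank_expr_eq_right; exists (tensor_mx Y).
  by rewrite -!tensor_mxX {1}AY tensor_mxM.
apply/seteqP; split; apply/trange_subP.
  exists (mx_tensor Y); apply: tensor_mx_inj.
  by rewrite tensor_mxM mx_tensorK !tensor_mxX.
by exists A; apply: tensor_mx_inj; rewrite tensor_mxM !tensor_mxX exprSr.
Qed.

Lemma tindP {I} (A : tensor C I I) : is_tind A (tind A).
Proof.
suff : [set k | is_tind A k]%classic (tind A) by [].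
apply: (@xgetPex _ _ [set k | is_tind A k]%classic).
have ex : exists j, `[< trange (tpow A j) = trange (tpow A j.+1) >].
  have [k kst] := rank_expr_stationary (tensor_mx A).
  by exists k; apply/asboolP/trange_tpow_eqE.
case: (ex_minnP ex) => k /asboolP kst kmin.
by exists k; split=> // j jst; apply/kmin/asboolP.
Qed.

Lemma is_drazinE {I} (A X : tensor C I I) :
  is_drazin A X <-> is_drazin_at (tind A) (tensor_mx A) (tensor_mx X).
Proof.
split=> -[e1 e2 e3]; split.
- by rewrite -!tensor_mxX -mulmxE -tensor_mxM e1.
- by rewrite -mulmxE -!tensor_mxM e2.
- by rewrite -mulmxE -!tensor_mxM e3.
- by apply: tensor_mx_inj; rewrite tensor_mxM !tensor_mxX.
- by apply: tensor_mx_inj; rewrite !tensor_mxM.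
- by apply: tensor_mx_inj; rewrite !tensor_mxM.
Qed.

Lemma drazinP {I} (A : tensor C I I) : is_drazin A (drazin A).
Proof.
suff : [set X | is_drazin A X]%classic (drazin A) by [].
apply: (@xgetPex _ _ [set X | is_drazin A X]%classic).
have [/trange_tpow_eqE kst _] := tindP A.
have [Y AY] := proj1 (rank_expr_eq_right _ _) kst.
have [Z AZ] := proj1 (rank_expr_eq_left _ _) kst.
have [X AX] := is_drazin_at_exists _ _ _ _ AY AZ.
by exists (mx_tensor X); apply/is_drazinE; rewrite mx_tensorK.
Qed.

End TensorMatrix.

Theorem theorem3p19 (R : realType) (N : nat) (I : 'I_N -> nat)
    (hI : forall s : 'I_N, (0 < I s)%N)
    (A : tensor R[i] I I) (k : nat) (hk : tind A = k)
    (l : nat) (hl : (k <= l)%N) :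
  drazin A = pinv (pinv (tpow A l) *_N tpow A (2 * l + 1) *_N pinv (tpow A l)).
Proof.
(* By uniqueness, it suffices that D satisfies the Penrose equations for X. *)
apply/esym/pinv_eq/is_pinvE; rewrite !tensor_mxM !tensor_mxX.
have /is_pinvE := pinvP (tpow A l); rewrite tensor_mxX => -[BBB B'BB' BBh B'Bh].
have /is_drazinE := drazinP A; rewrite hk => /(is_drazin_at_le _ _ _ _ hl) AD.
have [PD DP BBD] := drazin_inner_inverse _ _ _ _ AD BBB.
split; rewrite ?mulmxE ?PD ?DP -?mulmxE //.
(* What remains is X D X = X: the factor X D = B^+ B is absorbed by the leading B^+ of X. *)
- by rewrite !mulmxA B'BB'.
Qed.
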